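(* Let $m,d\ge1$ be integers, let $V=\{v(x),\ x\in\mathbb{R}^m\}$ be an $\mathbb{R}^d$-valued stochastic process with continuous sample paths, let $I\subset\mathbb{R}^m$ be a compact set of positive Lebesgue measure, and let $D\subset\mathbb{R}^d$. Assume that: (1) for any $x\in\mathbb{R}^m$, the random vector $v(x)$ has a density $p_x$, and there is a constant $C$ such that $$\sup_{z\in D^{(2)}}\ \sup_{x\in I^{(1)}}p_x(z)\le C;$$ (2) there exist $\delta\in\,]0,1]$ and a constant $C$ such that for any $q\in[1,\infty[$ and $x,y\in I^{(1)}$, $$E\left(\|v(x)-v(y)\|^q\right)\le C\,\|x-y\|^{q\delta}.$$ Then, for any $\gamma\in\,]0,d[$, there exists a positive constant $c$ such that for all small $\varepsilon\in\,]0,1[$, all $z\in D^{(1)}$ and any $j\in\mathbb{Z}^m$ with $R_j^\varepsilon\cap I\ne\varnothing$, $$P\{v(R_j^\varepsilon)\cap B_\varepsilon(z)\ne\varnothing\}\le c\,\varepsilon^\gamma,$$ where $R_j^\varepsilon=\prod_{l=1}^m[j_l\,\varepsilon^{1/\delta},(j_l+1)\,\varepsilon^{1/\delta}]$ for $j=(j_1,\dots,j_m)$. Consequently, for any $\gamma\in\,]0,d[$ there exists a positive constant $C$ such that for every Borel set $A\subset D$, $$P\{v(I)\cap A\ne\varnothing\}\le C\,\mathcal{H}_{\gamma-\frac{m}{\delta}}(A).$$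
   Context: For a set $S$, $v(S)$ denotes its (random) image under $x\mapsto v(x)$. $\|\cdot\|$ is the Euclidean norm and $B_r(x)$ is the open Euclidean ball with center $x$ and radius $r$. For $S\subset\mathbb{R}^n$ and $\nu>0$, $S^{(\nu)}$ is the $\nu$-enlargement of $S$, i.e. the set of points at distance less than $\nu$ from $S$. Hausdorff measure: for a Borel set $A\subset\mathbb{R}^d$, $\mathcal{H}_\gamma(A)=\infty$ if $\gamma<0$, and for $\gamma\ge0$, $$\mathcal{H}_\gamma(A)=\lim_{\varepsilon\to0^+}\inf\left\{\sum_{i=1}^\infty(2r_i)^\gamma:\ A\subset\bigcup_{i=1}^\infty B_{r_i}(x_i),\ \sup_{i\ge1}r_i\le\varepsilon\right\}.$$ *)

(* Defs.v *)
From HB Require Import structures.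
From mathcomp Require Import all_boot all_order all_algebra.
From mathcomp Require Import all_classical all_reals all_analysis.
From mathcomp Require Import measurable_realfun.

Set Implicit Arguments.
Unset Strict Implicit.
Unset Printing Implicit Defensive.
Import Order.TTheory GRing.Theory Num.Theory.
Import numFieldNormedType.Exports.
Local Open Scope classical_set_scope.
Local Open Scope ring_scope.

(* R^n is 'rV[R]_n. Its library topology comes from the sup norm, which induces
   the Euclidean topology; the sigma-algebra put on it here is the Borel one. *)
HB.instance Definition _ (R : realType) (n : nat) :=
  @isMeasurable.Build (sigma_display (@open 'rV[R]_n)) 'rV[R]_n
    <<s @open 'rV[R]_n >> (@sigma_algebra0 _ setT _)
    (@sigma_algebraC 'rV[R]_n (@open 'rV[R]_n))
    (@sigma_algebra_bigcup _ setT _).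

(* Lebesgue measure on R^n: iterated product of the Lebesgue measure on R,
   transported from n-tuples to row vectors. Lemma lebesgue_rV_box below gives
   its value on boxes. *)
Section lebesgue_rV.
Context {R : realType}.
Local Open Scope ereal_scope.

Definition cons_pair n (x : R * n.-tuple R) : n.+1.-tuple R :=
  [tuple of x.1 :: x.2].

Fixpoint lebesgue_tuple (n : nat) : set (n.-tuple R) -> \bar R :=
  match n with
  | 0%N => \d_[tuple]
  | k.+1 => pushforward (lebesgue_measure \x (@lebesgue_tuple k))
                        (@cons_pair k)
  end.

Lemma measurable_cons_pair n : measurable_fun setT (@cons_pair n).
Proof. exact: measurable_cons. Qed.

Let step n (mu : set (n.-tuple R) -> \bar R) :=
  pushforward (lebesgue_measure \x mu) (@cons_pair n).

Section step.
Variables (n : nat) (mu : {sigma_finite_measure set (n.-tuple R) -> \bar R}).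

Let pm : {measure set (n.+1.-tuple R) -> \bar R} :=
  measure_function_pushforward__canonical__measure_function_Measure
   (lebesgue_measure \x mu) (@measurable_cons_pair n).

HB.instance Definition _ := isMeasure.Build _ _ _ (step mu)
  (measure0 pm) (measure_ge0 pm) (@measure_semi_sigma_additive _ _ _ pm).

Let step_sigma_finite : sigma_finite setT (step mu).
Proof.
have [F [FT ndF Foo]] := (sigma_finiteP _ _).1 (sigma_finiteT (@lebesgue_measure R)).
have [G [GT ndG Goo]] := (sigma_finiteP _ _).1 (sigma_finiteT mu).
pose un (t : n.+1.-tuple R) := (thead t, [tuple of behead t]).
have mun : measurable_fun setT un.
  by apply: measurable_fun_pair; [exact: measurable_tnth|exact: measurable_behead].
exists (fun k => un @^-1` (F k `*` G k)).
  rewrite -preimage_bigcup (_ : \bigcup_k _ = setT) ?preimage_setT//.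
  apply/seteqP; split=> // -[x y] _.
  have [i _ Fix] : (\bigcup_k F k) x by rewrite -FT.
  have [j _ Gjy] : (\bigcup_k G k) y by rewrite -GT.
  exists (maxn i j) => //; split => /=.
  - by move: Fix; exact/subsetPset/ndF/leq_maxl.
  - by move: Gjy; exact/subsetPset/ndG/leq_maxr.
move=> k; have [mF Fk] := Foo k; have [mG Gk] := Goo k; split.
  by rewrite -[X in measurable X]setTI; apply: mun => //; exact: measurableX.
rewrite /step /pushforward -comp_preimage (_ : un \o _ = id); last first.
  apply/funext => -[x t]; rewrite /un/= theadE; congr pair; exact/val_inj.
by rewrite preimage_id product_measure1E// lte_mul_pinfty// ge0_fin_numE.
Qed.

HB.instance Definition _ := Measure_isSigmaFinite.Build _ _ _ (step mu)
  step_sigma_finite.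

Definition lebesgue_tuple_step :
  {sigma_finite_measure set (n.+1.-tuple R) -> \bar R} := step mu.

End step.

Lemma lebesgue_tuple_spec n :
  exists mu : {sigma_finite_measure set (n.-tuple R) -> \bar R},
    (mu : set _ -> _) = @lebesgue_tuple n.
Proof.
elim: n => [|n [mu muE]]; first by exists \d_[tuple].
by exists (lebesgue_tuple_step mu) => /=; rewrite -muE.
Qed.

Section tuple_instance.
Variable n : nat.
Let h0 : @lebesgue_tuple n set0 = 0.
Proof. by have [mu <-] := lebesgue_tuple_spec n. Qed.
Let h1 A : 0 <= @lebesgue_tuple n A.
Proof. by have [mu <-] := lebesgue_tuple_spec n. Qed.
Let h2 : semi_sigma_additive (@lebesgue_tuple n).
Proof.
have [mu <-] := lebesgue_tuple_spec n; exact: measure_semi_sigma_additive.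
Qed.
HB.instance Definition _ := isMeasure.Build _ _ _ (@lebesgue_tuple n) h0 h1 h2.
Let h3 : sigma_finite setT (@lebesgue_tuple n).
Proof. have [mu <-] := lebesgue_tuple_spec n; exact: sigma_finiteT. Qed.
HB.instance Definition _ := Measure_isSigmaFinite.Build _ _ _
  (@lebesgue_tuple n) h3.
End tuple_instance.

Definition row_of_tuple n (t : n.-tuple R) : 'rV[R]_n := \row_i tnth t i.

Let qball n (ce : 'rV[rat]_n * rat) : set 'rV[R]_n :=
  ball (map_mx (ratr : rat -> R) ce.1 : 'rV[R]_n) (ratr ce.2 : R).

Let open_rV_bigcup n (U : set 'rV[R]_n) : open U ->
  U = \bigcup_(ce in [set ce | qball ce `<=` U]) qball ce.
Proof.
move=> oU; apply/seteqP; split=> [x Ux|x [ce /= sU]]; last exact: sU.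
have : nbhs x U by apply: open_nbhs_nbhs.
move=> /nbhs_ballP[e /= e0 xU].
have [r] := rat_in_itvoo (divr_gt0 e0 (ltr0Sn R 1)).
rewrite in_itv/= => /andP[r0 re].
have /choice[c cx] : forall i, exists c : rat, ball (ratr c : R) (ratr r) (x ord0 i).
  move=> i; have : (x ord0 i - ratr r < x ord0 i + ratr r)%R by rewrite ltrD2l gtrN.
  move=> /rat_in_itvoo[c]; rewrite in_itv/= => /andP[c1 c2]; exists c.
  by rewrite /ball/= ltr_distlC ltrBlDr c2 -ltrBlDr c1.
have cxb : qball (\row_i c i, r) x.
  split=> //= i j; rewrite !mxE (ord1 i); exact: cx.
exists (\row_i c i, r) => //= y cy; apply: xU.
have : ball x (ratr r + ratr r) y by apply: ball_triangle cy; exact: ball_sym.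
apply: le_ball; rewrite (splitr e); exact/ltW/ltrD.
Qed.

Lemma measurable_row_of_tuple n : measurable_fun setT (@row_of_tuple n).
Proof.
apply: (@measurability _ _ _ _ _ _ (@open 'rV[R]_n)) => // _ [U oU <-].
rewrite setTI (open_rV_bigcup oU) preimage_bigcup bigcup_mkcond.
apply: countable_bigcupT_measurable => // -[c e].
case: ifPn => // _ /=.
have [e0|e0] := leP (ratr e : R) 0%R.
  rewrite [X in measurable X](_ : _ = set0)//.
  by apply/seteqP; split => // t [/=]; rewrite ltNge e0.
rewrite [X in measurable X](_ : _ = \bigcap_(i in [set: 'I_n])
  (@tnth _ R ^~ i) @^-1` ball (ratr (c ord0 i) : R) (ratr e)); last first.
  apply/seteqP; split => [t [_ /= ct] i _|t ct]; rewrite /preimage/=.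
    by have := ct ord0 i; rewrite !mxE.
  by split => // i j; rewrite (ord1 i) !mxE; exact: ct.
apply: fin_bigcap_measurable => // i _.
rewrite -[X in measurable X]setTI.
by apply: measurable_tnth => //; apply: open_measurable; exact: ball_open.
Qed.

Definition lebesgue_rV n : set 'rV[R]_n -> \bar R :=
  pushforward (@lebesgue_tuple n) (@row_of_tuple n).

Section measure_instance.
Variable n : nat.
Let pm : {measure set 'rV[R]_n -> \bar R} :=
  measure_function_pushforward__canonical__measure_function_Measure
   (@lebesgue_tuple n) (@measurable_row_of_tuple n).
HB.instance Definition _ := isMeasure.Build _ _ _ (@lebesgue_rV n)
  (measure0 pm) (measure_ge0 pm) (@measure_semi_sigma_additive _ _ _ pm).
End measure_instance.

Let lebesgue_tuple_box n (a b : 'I_n -> R) : (forall i, (a i <= b i)%R) ->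
  lebesgue_tuple [set t : n.-tuple R | forall i, (a i <= tnth t i <= b i)%R] =
  (\prod_i (b i - a i)%R)%:E.
Proof.
elim: n a b => [|n IHn] a b ab.
  rewrite big_ord0 /= diracE mem_set//; by case.
rewrite /= /pushforward.
rewrite (_ : _ @^-1` _ = `[a ord0, b ord0] `*`
   [set t : n.-tuple R | forall i, (a (lift ord0 i) <= tnth t i <= b (lift ord0 i))%R]).
  rewrite product_measure1E; last 2 first.
  - exact: measurable_itv.
  - rewrite [X in measurable X](_ : _ = \bigcap_(i in [set: 'I_n])
      (@tnth _ R ^~ i) @^-1` `[a (lift ord0 i), b (lift ord0 i)]).
      apply: fin_bigcap_measurable => // i _; rewrite -[X in measurable X]setTI.
      by apply: measurable_tnth => //; exact: measurable_itv.
    by apply/seteqP; split => t /= h i => [_|]; have := h i; rewrite /= in_itv/=; auto.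
  rewrite big_ord_recl EFinM; congr (_ * _); last first.
    by rewrite -(IHn (fun i => a (lift ord0 i)) (fun i => b (lift ord0 i))).
  rewrite [LHS]lebesgue_measure_itv/= lte_fin; case: ltgtP (ab ord0) => // -> _.
  by rewrite subrr.
have tS (x : R) (t : n.-tuple R) i :
  tnth (cons_pair (x, t)) (lift ord0 i) = tnth t i by exact: tnthS.
apply/seteqP; split=> [[x t] h|[x t] [xab h] i].
  split=> [|i]; first by rewrite /= in_itv; exact: (h ord0).
  by rewrite -(tS x); exact: h.
case: (unliftP ord0 i) => [j|] ->; first by rewrite tS; exact: h.
by move: xab; rewrite /= in_itv.
Qed.

Lemma lebesgue_rV_box n (a b : 'rV[R]_n) :
  (forall i, (a ord0 i <= b ord0 i)%R) ->
  lebesgue_rV [set x | forall i, (a ord0 i <= x ord0 i <= b ord0 i)%R] =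
  (\prod_i (b ord0 i - a ord0 i)%R)%:E.
Proof.
move=> /lebesgue_tuple_box <-; rewrite /lebesgue_rV /pushforward.
by congr lebesgue_tuple; apply/seteqP; split=> t /= h i; have := h i; rewrite mxE.
Qed.

End lebesgue_rV.

Section euclidean.
Context {R : realType} {n : nat}.
Implicit Types (x : 'rV[R]_n) (r nu : R) (S : set 'rV[R]_n).

Definition enorm x : R := Num.sqrt (\sum_(i < n) x ord0 i ^+ 2).

Definition eball x r : set 'rV[R]_n := [set y | enorm (y - x) < r].

Definition enlargement S nu : set 'rV[R]_n :=
  [set x | (ereal_inf [set (enorm (x - y))%:E | y in S] < nu%:E)%E].

End euclidean.

Definition has_density d (T : measurableType d) (R : realType)
    (P : probability T R) (n : nat) (X : {RV P >-> 'rV[R]_n})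
    (p : 'rV[R]_n -> R) : Prop :=
  [/\ measurable_fun [set: 'rV[R]_n] p,
      forall z, 0 <= p z
    & forall B : set 'rV[R]_n, measurable B ->
        distribution P X B = (\int[lebesgue_rV (n := n)]_(z in B) (p z)%:E)%E].

Section hausdorff.
Context {R : realType} {n : nat}.
Implicit Types (A : set 'rV[R]_n) (gamma eps r : R).

(* pairs (centers, radii) of countable covers of A by open balls *)
Definition ball_covers A eps : set ((nat -> 'rV[R]_n) * (nat -> R)) :=
  [set xr | (forall i, 0 <= xr.2 i <= eps) /\
            A `<=` \bigcup_i eball (xr.1 i) (xr.2 i)].

(* A ball of radius 0 is empty and contributes 0, also when gamma = 0 (whereas
   0 `^ 0 = 1). Thus sequences of balls include finite covers, and the
   0-dimensional Hausdorff measure is the counting measure instead of being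
   infinite on every set. *)
Definition diam_powR gamma r : R := if r == 0 then 0 else (2 * r) `^ gamma.

Definition hausdorff_content gamma eps A : \bar R :=
  ereal_inf [set (\sum_(0 <= i <oo) (diam_powR gamma (xr.2 i))%:E)%E
            | xr in ball_covers A eps].

Definition hausdorff_measure gamma A : \bar R :=
  if gamma < 0 then +oo%E
  else lim (hausdorff_content gamma eps A @[eps --> 0^'+]).

End hausdorff.

Definition grid_box (R : realType) (m : nat) (delta eps : R) (j : 'rV[int]_m) :
    set 'rV[R]_m :=
  [set x | forall l, (j ord0 l)%:~R * eps `^ delta^-1 <= x ord0 l
                     <= ((j ord0 l)%:~R + 1) * eps `^ delta^-1].

Definition hits (Omega U V : Type) (v : U -> Omega -> V) (S : set U) (A : set V) :
    set Omega :=
  [set w | ((v ^~ w) @` S) `&` A !=set0].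

(* Main.v *)
Require Import Defs.
From HB Require Import structures.
From mathcomp Require Import all_boot all_order all_algebra.
From mathcomp Require Import all_classical all_reals all_analysis.
From mathcomp Require Import measurable_realfun.
From mathcomp Require Import zify ring lra.


(** The moment bound holds with the same constant [C2] for every exponent [q].
    By Markov's inequality,
    [P(enorm (v x - v y) >= a) <= C2 * (enorm (x - y) `^ delta / a) ^+ n] for
    all [n], and the right-hand side tends to 0 as soon as
    [a > enorm (x - y) `^ delta]. So the increments satisfy, almost surely, a
    deterministic Hoelder bound of exponent [delta] (moments_bound_null).

    A grid box has sides [eps `^ delta^-1], so over such a box [v] moves by at
    most a multiple of [eps] away from its value at any fixed point [x0] of the
    box. Up to a null event, if the image of the box meets the ball of radius
    [eps] at [z], then [v x0] lies in a cube of side a multiple of [eps]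
    centred at [z]; since [v x0] has a density bounded near [D], this has
    probability at most [c * eps ^+ d] (hits_ball_le, hits_grid_box_le). Sample
    continuity is what makes the uncountable union over the box harmless: the
    ball is open, so it is enough to look at a dense sequence of points of the
    box. This gives the first claim, because [eps ^+ d <= eps `^ gamma] for
    [eps <= 1].

    For the second claim, cover [A] by balls of radii [r i]. The compact set [I]
    meets at most a multiple of [r i `^ (- (m / delta))] boxes of the grid of
    scale [r i] (grid_cover), so [v] maps some point of [I] into the i-th ball
    with probability at most a multiple of [r i `^ (d - m / delta)]
    (hits_compact_le). Summing over the balls and optimizing over the covers
    bounds the outer probability by the Hausdorff content at every small scale,
    hence by its limit, the Hausdorff measure (mu_ext_hits_le). *)

Set Implicit Arguments.
Unset Strict Implicit.
Unset Printing Implicit Defensive.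
Import Order.TTheory GRing.Theory Num.Theory.
Import numFieldNormedType.Exports.
Local Open Scope classical_set_scope.
Local Open Scope ring_scope.

(** * Euclidean norm, dense sequences and Borel sets *)

Section euclidean_facts.
Context {R : realType} {n : nat}.
Implicit Types (x y z : 'rV[R]_n) (a : R) (S U : set 'rV[R]_n).

Lemma enorm_ge0 x : 0 <= enorm x.
Proof. exact: sqrtr_ge0. Qed.

Lemma sqr_enorm x : enorm x ^+ 2 = \sum_(i < n) x ord0 i ^+ 2.
Proof. by rewrite sqr_sqrtr// sumr_ge0// => i _; exact: sqr_ge0. Qed.

Lemma enormN x : enorm (- x) = enorm x.
Proof. by congr Num.sqrt; apply: eq_bigr => i _; rewrite mxE sqrrN. Qed.

Lemma coord_le_enorm x i : `|x ord0 i| <= enorm x.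
Proof.
rewrite -(@ler_pXn2r _ 2) ?nnegrE ?enorm_ge0// sqr_enorm real_normK ?num_real//.
by rewrite (bigD1 i)//= lerDl sumr_ge0// => j _; exact: sqr_ge0.
Qed.

Lemma enorm_le x a : 0 <= a -> (forall i, `|x ord0 i| <= a) ->
  enorm x <= n%:R * a.
Proof.
move=> a0 xa; rewrite -(@ler_pXn2r _ 2) ?nnegrE ?enorm_ge0 ?mulr_ge0//.
rewrite sqr_enorm; apply: (@le_trans _ _ (\sum_(i < n) a ^+ 2)).
  by apply: ler_sum => i _; rewrite -(real_normK (num_real (x ord0 i))) lerXn2r ?nnegrE.
rewrite sumr_const card_ord exprMn -[leLHS]mulr_natl -natrX.
rewrite ler_wpM2r ?sqr_ge0// ler_nat.
by case: (n) => // k; rewrite -mulnn leq_pmulr.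
Qed.

(** This weak form of the triangle inequality suffices to pass from the
    1-enlargement of a set to its 2-enlargement: two vectors of norm less than 1
    have a sum of squared norm less than 4. *)
Lemma sqr_enormD x y : enorm (x + y) ^+ 2 <= (enorm x ^+ 2 + enorm y ^+ 2) *+ 2.
Proof.
rewrite !sqr_enorm -big_split -sumrMnl; apply: ler_sum => i _ /=; rewrite mxE.
by have := sqr_ge0 (x ord0 i - y ord0 i); nra.
Qed.

Lemma continuous_enorm : continuous (@enorm R n).
Proof.
move=> x; apply: (@continuous_comp _ _ _ (fun x => \sum_(i < n) x ord0 i ^+ 2)).
  apply: continuous_big => [|i _ y]; first exact: add_continuous.
  apply: (@continuous_comp _ _ _ (fun y : 'rV[R]_n => y ord0 i) (fun t => t ^+ 2)).
    exact: coord_continuous.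
  exact: exprn_continuous.
exact: sqrt_continuous.
Qed.

Lemma open_eball z a : open (eball z a).
Proof.
rewrite (_ : eball z a = (fun y => enorm (y - z)) @^-1` [set t | t < a])//.
apply: open_comp; last exact: open_lt.
move=> y _; apply: (@continuous_comp _ _ _ (fun y => y - z)).
  by apply: continuousB => //; exact: cst_continuous.
exact: continuous_enorm.
Qed.

Lemma enlargementP S a x :
  enlargement S a x <-> exists2 y, S y & enorm (x - y) < a.
Proof.
split=> [/ereal_inf_lt[_ [y Sy <-]]|[y Sy xy]].
  by rewrite lte_fin; exists y.
by apply: (@le_lt_trans _ _ (enorm (x - y))%:E); [apply: ereal_inf_lbound; exists y|
  rewrite lte_fin].
Qed.

(** Second countability in the form used below: among the countably many open
    cubes with rational data, each one that meets [S] contributes one point. *)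
Lemma dense_sequence S : S !=set0 ->
  exists s : nat -> 'rV[R]_n, (forall k, S (s k)) /\
    forall U, open U -> U `&` S !=set0 -> exists k, U (s k).
Proof.
move=> [x0 Sx0].
pose B (c : 'rV[rat]_n * rat) : set 'rV[R]_n :=
  [set y | forall i, `|y ord0 i - ratr (c.1 ord0 i)| < ratr c.2].
have /choice[g gS] (k : nat) : exists y, S y /\
    forall c, unpickle k = Some c -> B c `&` S !=set0 -> B c y.
  case: (unpickle k) => [c|]; last by exists x0.
  have [[y [By Sy]]|BS] := pselect (B c `&` S !=set0).
    by exists y; split=> // _ [<-].
  by exists x0; split=> // _ [<-].
exists g; split=> [k|U oU [x [Ux Sx]]]; first by case: (gS k).
have /nbhs_ballP[e /= e0 xU] : nbhs x U by exact: open_nbhs_nbhs.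
(* A rational cube of half-side [r < e / 2] around [x] stays in [ball x e]. *)
have [r] := rat_in_itvoo (divr_gt0 e0 (ltr0Sn R 1)).
rewrite in_itv/= => /andP[r0 re].
have /choice[c cx] i : exists c : rat, `|x ord0 i - ratr c| < ratr r.
  have : x ord0 i - ratr r < x ord0 i + ratr r by rewrite ltrD2l gtrN.
  move=> /rat_in_itvoo[c]; rewrite in_itv/= => /andP[c1 c2]; exists c.
  by rewrite ltr_norml; apply/andP; split; lra.
pose b : 'rV[rat]_n * rat := (\row_i c i, r).
have [_ /(_ b)] := gS (pickle b).
rewrite pickleK => /(_ erefl) gB; exists (pickle b).
apply: xU; split=> // i j; rewrite ord1.
have /gB/(_ j) : B b `&` S !=set0 by exists x; split=> // k; rewrite mxE.
have := cx j; rewrite /= mxE !ltr_norml => /andP[? ?] /andP[? ?].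
by rewrite /ball/= ltr_norml; apply/andP; split; lra.
Qed.

End euclidean_facts.

Section borel.
Context {R : realType} {n : nat}.

Lemma measurable_coord (i : 'I_n) :
  measurable_fun setT (fun x : 'rV[R]_n => x ord0 i).
Proof.
apply: (measurability _ (RGenOpens.measurableE R)) => _ [_ [a [b ->]] <-].
rewrite setTI; apply: sub_sigma_algebra.
by apply: open_comp => [x _|]; [exact: coord_continuous|exact: interval_open].
Qed.

Lemma open_measurable_rV (U : set 'rV[R]_n) : open U -> measurable U.
Proof. exact: sub_sigma_algebra. Qed.

End borel.

(** * Almost sure control of the increments, and hitting events *)

Section process.
Context {R : realType} {disp : measure_display} {Omega : measurableType disp}
  {P : probability Omega R}.

(** Moments growing no faster than [h `^ q] force [f <= h] almost surely: by
    Markov, [P(a <= f)] is at most [C * (h / a) ^+ n] for every [n]. The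
    independence of [C] from [q] is essential here. *)
Lemma moments_bound_null (f : Omega -> R) (h a C : R) :
  measurable_fun setT f -> (forall w, 0 <= f w) -> 0 <= h < a ->
  (forall q : R, 1 <= q -> ('E_P[fun w => (f w `^ q)%R] <= (C * h `^ q)%:E)%E) ->
  P [set w | a <= f w] = 0%E.
Proof.
move=> mf f0 /andP[h0 ha] fq; have a0 : 0 < a by exact: le_lt_trans ha.
set A := [set w | _].
have mA : measurable A.
  rewrite (_ : A = f @^-1` `[a, +oo[%classic).
    by rewrite -[X in measurable X]setTI; apply: mf => //; exact: measurable_itv.
  by apply/seteqP; split=> w; rewrite /A/= in_itv/= andbT.
have PAfin : P A \is a fin_num by exact: fin_num_measure.
have PA n : fine (P A) <= C * (h / a) ^+ n.+1.
  rewrite expr_div_n mulrA ler_pdivlMr ?exprn_gt0// -lee_fin EFinM fineK//.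
  have := fq n.+1%:R; rewrite ler1n => /(_ isT); rewrite powR_mulrn//.
  apply: le_trans; rewrite expectation.unlock muleC.
  have -> : A = setT `&` [set w | ((a ^+ n.+1)%:E <= `|(f w ^+ n.+1)%:E|)%E].
    rewrite setTI /A; apply/funext => w /=.
    by rewrite lee_fin ger0_norm ?exprn_ge0// ler_pXn2r ?nnegrE ?(ltW a0).
  have := @le_integral_comp_abse _ _ _ P setT measurableT
    (fun w => (f w ^+ n.+1)%:E) (a ^+ n.+1) id.
  move=> /(_ (@measurable_id _ _ _) (fun _ => id) (fun _ _ _ _ => id)).
  move=> /(_ _ (exprn_gt0 _ a0)) /le_trans; apply.
    by apply/measurable_EFinP; exact: measurable_funX.
  rewrite le_eqVlt; apply/orP; left; apply/eqP; apply: eq_integral => w _.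
  by rewrite powR_mulrn// gee0_abs// lee_fin exprn_ge0.
apply/eqP; rewrite eq_le measure_ge0 andbT -(fineK PAfin) lee_fin.
apply: (@cvgr_to_ge _ \oo _ _ (fun n => C * (h / a) ^+ n.+1) 0); last exact: nearW.
rewrite -(mulr0 C); apply: cvgMr.
have /cvg_expr : `|h / a| < 1.
  by rewrite ger0_norm ?divr_ge0 ?(ltW a0)// ltr_pdivrMr ?mul1r.
by rewrite -cvg_shiftS.
Qed.

Lemma measurable_increment n (X Y : {RV P >-> 'rV[R]_n}) :
  measurable_fun setT (fun w => enorm (X w - Y w : 'rV[R]_n)).
Proof.
apply: (measurableT_comp (continuous_measurable_fun (@sqrt_continuous R))).
apply: measurable_sum => i; apply: measurable_funX.
rewrite (_ : (fun w => _) = (fun w => (X w : 'rV[R]_n) ord0 i - (Y w : 'rV[R]_n) ord0 i)).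
  by apply: measurable_funB; apply: (measurableT_comp (measurable_coord i)).
by apply/funext => w; rewrite !mxE.
Qed.

Context {m d : nat} (v : 'rV[R]_m -> {RV P >-> 'rV[R]_d}).
Context (v_continuous : forall w, continuous (fun x => v x w : 'rV[R]_d)).

(** By sample continuity, the points of [S] sent into an open set form a
    relatively open subset of [S], which is empty or contains a term of a dense
    sequence. The sequence depends neither on the outcome nor on the target. *)
Lemma hits_sequence (S : set 'rV[R]_m) : S !=set0 ->
  exists s : nat -> 'rV[R]_m, (forall k, S (s k)) /\
    forall U : set 'rV[R]_d, open U -> hits v S U = \bigcup_k (v (s k) @^-1` U).
Proof.
move=> /dense_sequence[s [Ss dS]]; exists s; split=> // U oU.
apply/seteqP; split=> [w [_ [[x Sx <-] Uvx]]|w [k _ Uvs]].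
  have [k] : exists k, ((fun x => v x w) @^-1` U) (s k).
    apply: dS; last by exists x.
    by apply: open_comp => // y _; exact: v_continuous.
  by exists k.
by exists (v (s k) w); split=> //; exists (s k).
Qed.

Lemma measurable_hits (S : set 'rV[R]_m) (U : set 'rV[R]_d) :
  open U -> measurable (hits v S U).
Proof.
move=> oU; case: (eqVneq S set0) => [->|/set0P S0].
  rewrite (_ : hits _ _ _ = set0)//.
  by apply/seteqP; split=> // w [y [[x []]]].
have [s [_ /(_ U oU) ->]] := hits_sequence S0.
apply: bigcup_measurable => k _.
by apply: measurable_funPTI; exact: open_measurable_rV.
Qed.

(** Outside the null event that some [v (s k)] of a dense sequence is at
    distance at least [a] from [v x0], hitting the ball forces [v x0] into the
    cube of half-side [eps + a] centred at [z], whose probability is at most the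
    bound on the density times its volume. A cube is used because its Lebesgue
    measure is explicit. *)
Lemma hits_ball_le (S : set 'rV[R]_m) (x0 : 'rV[R]_m) (p : 'rV[R]_d -> R)
    (z : 'rV[R]_d) (eps eta a C1 C2 : R) :
  has_density (v x0) p -> S x0 -> 0 < eps -> 0 <= eta < a ->
  (forall x, S x -> forall q : R, 1 <= q ->
    ('E_P[fun w => (enorm (v x w - v x0 w : 'rV[R]_d) `^ q)%R]
       <= (C2 * eta `^ q)%:E)%E) ->
  (forall y, (forall i, `|(y - z) ord0 i| <= eps + a) -> p y <= C1) ->
  (P (hits v S (eball z eps)) <= (C1 * (2 * (eps + a)) ^+ d)%:E)%E.
Proof.
move=> [mp p0 Pp] Sx0 eps0 /andP[eta0 etaa] moments pC1.
have a0 : 0 < a by exact: le_lt_trans etaa.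
have [s [Ss sE]] : exists s : nat -> 'rV[R]_m, (forall k, S (s k)) /\
    forall U : set 'rV[R]_d, open U -> hits v S U = \bigcup_k (v (s k) @^-1` U).
  by apply: hits_sequence; exists x0.
(* [N k] is negligible as [eta < a]. *)
pose N k := [set w | a <= enorm (v (s k) w - v x0 w : 'rV[R]_d)].
have mN k : measurable (N k).
  rewrite (_ : N k =
    (fun w => enorm (v (s k) w - v x0 w : 'rV[R]_d)) @^-1` `[a, +oo[%classic).
    rewrite -[X in measurable X]setTI.
    exact: (measurable_increment (v (s k)) (v x0) measurableT (measurable_itv _)).
  by apply/seteqP; split=> w; rewrite /N/= in_itv/= andbT.
have PN0 : P (\bigcup_k N k) = 0%E.
  apply/eqP; rewrite eq_le measure_ge0 andbT.
  have mUN : measurable (\bigcup_k N k) by exact: bigcup_measurable.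
  have := measure_sigma_subadditive P mN mUN (@subset_refl _ _).
  move=> /le_trans; apply; rewrite eseries0 ?lexx// => k _ _.
  apply: (@moments_bound_null (fun w => enorm (v (s k) w - v x0 w : 'rV[R]_d)) eta a C2).
  - exact: measurable_increment.
  - by move=> w; exact: enorm_ge0.
  - by rewrite eta0.
  - by move=> q; exact: moments.
pose Q : set 'rV[R]_d := [set y | forall i, (z - const_mx (eps + a)) ord0 i <= y ord0 i
                                       <= (z + const_mx (eps + a)) ord0 i].
have mQ : measurable Q.
  rewrite (_ : Q = \bigcap_(i in [set: 'I_d]) ((fun y : 'rV[R]_d => y ord0 i) @^-1`
      `[(z - const_mx (eps + a)) ord0 i, (z + const_mx (eps + a)) ord0 i]%classic)).
    apply: fin_bigcap_measurable => // i _; rewrite -[X in measurable X]setTI.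
    by apply: measurable_coord => //; exact: measurable_itv.
  by apply/seteqP; split=> [y Qy i _|y Qy i]; have := Qy i; rewrite /= in_itv/=; exact.
have QE y : Q y <-> forall i, `|(y - z) ord0 i| <= eps + a.
  split=> Qy i; have := Qy i; rewrite !mxE ler_norml => /andP[? ?];
  by apply/andP; split; lra.
have hitsQ : hits v S (eball z eps) `<=` (v x0 @^-1` Q) `|` \bigcup_k N k.
  rewrite sE; last exact: open_eball.
  move=> w [k _ vsz]; have [aw|wa] := leP a (enorm (v (s k) w - v x0 w : 'rV[R]_d)).
    by right; exists k.
  left; apply/QE => i.
  have := le_lt_trans (coord_le_enorm _ i) vsz.
  have := le_lt_trans (coord_le_enorm _ i) wa.
  by rewrite !mxE !ltr_norml ler_norml => /andP[? ?] /andP[? ?]; apply/andP; split; lra.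
have mvQ : measurable (v x0 @^-1` Q) by exact: measurable_funPTI.
have mUN : measurable (\bigcup_k N k) by exact: bigcup_measurable.
apply: (@le_trans _ _ (P ((v x0 @^-1` Q) `|` \bigcup_k N k))).
  apply: le_measure hitsQ; rewrite inE; last exact: measurableU.
  exact: measurable_hits (@open_eball _ _ _ _).
rewrite measureU0// -[X in (X <= _)%E]/(distribution P (v x0) Q) Pp//.
have C10 : 0 <= C1.
  apply: (le_trans (p0 z)); apply: pC1 => i.
  by rewrite subrr mxE normr0 addr_ge0// ltW.
apply: (@le_trans _ _ (\int[lebesgue_rV (n := d)]_(y in Q) C1%:E)%E).
  apply: ge0_le_integral => //.
  - by move=> y _; rewrite lee_fin.
  - by apply/measurable_EFinP; exact: measurable_funTS.
  - by move=> y Qy; rewrite lee_fin; apply: pC1; exact/QE.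
have QV : lebesgue_rV Q = ((2 * (eps + a)) ^+ d)%:E.
  rewrite /Q lebesgue_rV_box.
    rewrite (eq_bigr (fun=> 2 * (eps + a))) ?prodr_const ?card_ord// => i _.
    by rewrite !mxE; lra.
  by move=> i; rewrite !mxE; lra.
by rewrite integral_cst// EFinM -QV lexx.
Qed.

End process.

(** * Counting grid boxes *)

(** The index of the box containing [x] is the vector of the floors of
    [x ord0 l / s], so all indices needed lie in [- N, N] with [N] of order
    [M / s]. *)
Lemma grid_cover (R : realType) (m : nat) (I : set 'rV[R]_m) (M s : R) :
  0 <= M -> (forall x, I x -> forall l, `|x ord0 l| <= M) -> 0 < s <= 1 ->
  exists J : seq 'rV[int]_m,
    (size J)%:R <= (2 * M + 3) ^+ m / s ^+ m /\
    forall x, I x -> exists2 j, j \in J &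
      forall l, (j ord0 l)%:~R * s <= x ord0 l <= ((j ord0 l)%:~R + 1) * s.
Proof.
move=> M0 IM /andP[s0 s1]; pose N := Num.truncn ((M + 1) / s).
(* One unit more than [M] makes [N * s >= M] in spite of the truncation. *)
have Ms0 : 0 <= (M + 1) / s by rewrite divr_ge0 ?addr_ge0// ltW.
pose j (k : {ffun 'I_m -> 'I_(N.*2.+1)}) : 'rV[int]_m :=
  \row_l ((k l : nat)%:Z - N%:Z).
exists [seq j k | k <- enum {ffun 'I_m -> 'I_(N.*2.+1)}]; split.
  rewrite size_map -cardE card_ffun !card_ord natrX -expr_div_n.
  apply: lerXn2r; rewrite ?nnegrE ?divr_ge0//; [|exact: ltW|].
    by rewrite addr_ge0// mulr_ge0.
  rewrite -natr1 -mul2n natrM ler_pdivlMr//.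
  have : N%:R * s <= M + 1 by rewrite -ler_pdivlMr// truncn_le.
  by lra.
move=> x Ix.
have MN : M <= N%:R * s.
  have : (M + 1) / s < N.+1%:R by exact: truncnS_gt.
  by rewrite ltr_pdivrMr// -natr1; lra.
have k_ub l : (`|(Num.floor (x ord0 l / s) + N%:Z)%R|%N < N.*2.+1)%N /\
    (0 <= Num.floor (x ord0 l / s) + N%:Z).
  have := IM _ Ix l; rewrite ler_norml => /andP[xM1 xM2].
  have fN1 : - N%:Z <= Num.floor (x ord0 l / s).
    by rewrite floor_ge_int rmorphN/= ler_pdivlMr//; lra.
  have fN2 : Num.floor (x ord0 l / s) <= N%:Z.
    rewrite -(ler_int R); apply: (le_trans (floor_le _)).
    by rewrite ler_pdivrMr//; lra.
  split; last lia.
  lia.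
exists (j [ffun l => Ordinal (k_ub l).1]).
  by apply/map_f; rewrite mem_enum.
move=> l; rewrite mxE ffunE /= gez0_abs ?(k_ub l).2// addrK.
have /andP[] := floor_itv (x ord0 l / s).
by rewrite ler_pdivlMr// ltr_pdivrMr// intrD => -> /ltW ->.
Qed.

(** * From balls to Hausdorff measure *)

(** Countable subadditivity over a cover of [A] bounds the outer probability by
    [c] times the Hausdorff content at every scale below [e0]; the content
    increases as the scale decreases, so the limit exists and obeys the same
    bound. *)
Lemma mu_ext_hits_le (R : realType) (disp : measure_display)
    (Omega : measurableType disp) (P : probability Omega R)
    (m d : nat) (v : 'rV[R]_m -> {RV P >-> 'rV[R]_d})
    (v_continuous : forall w, continuous (fun x => v x w : 'rV[R]_d))
    (I : set 'rV[R]_m) (D A : set 'rV[R]_d) (g c e0 : R) :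
  0 <= g -> 0 < c -> 0 < e0 -> A `<=` D ->
  (forall r z, 0 < r < e0 -> enlargement D 1 z ->
    (P (hits v I (eball z r)) <= (c * r `^ g)%:E)%E) ->
  (mu_ext P (hits v I A) <= c%:E * hausdorff_measure g A)%E.
Proof.
move=> g0 c0 e00 AD Pc.
rewrite /hausdorff_measure ltNge g0 /= -lee_pdivrMl//.
apply: lime_ge.
  apply: nonincreasing_at_right_is_cvge; apply: nearW => e1 e e' _ _ ee'.
  apply: ereal_inf_le_tmp => _ [xr [xr0 Axr] <-]; exists xr => //; split=> // i.
  by have /andP[-> /=] := xr0 i; move=> /le_trans; apply.
near=> e.
have e_gt0 : 0 < e by near: e; exact: nbhs_right_gt.
have ee0 : e < e0 by near: e; exact: nbhs_right_lt.
have e1 : e < 1 by near: e; exact: nbhs_right_lt.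
apply: le_ereal_inf_tmp => _ [[x r] /= [re Axr] <-].
rewrite lee_pdivrMl// -nneseriesZl; last first.
  by move=> i _; rewrite lee_fin /diam_powR; case: ifPn => // _; exact: powR_ge0.
(* Balls that miss [A] may lie far from [D], where nothing is known: drop them. *)
pose F i := if `[< eball (x i) (r i) `&` A !=set0 >]
  then hits v I (eball (x i) (r i)) else set0.
have mF i : measurable (F i).
  rewrite /F; case: asboolP => // _; apply: measurable_hits => //.
  exact: open_eball.
apply: (@le_trans _ _ (\sum_(0 <= i <oo) P (F i))%E).
  apply: ereal_inf_lbound; exists F => //; split=> // w [y [vy Ay]].
  have [i _ yi] := Axr _ Ay; exists i => //; rewrite /F.
  by rewrite asboolT; exists y.
apply: lee_nneseries => // i _; rewrite /F; case: asboolP => [[y [yi Ay]]|_]; last first.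
  rewrite measure0 mule_ge0 ?lee_fin ?(ltW c0)// /diam_powR.
  by case: ifPn => // _; exact: powR_ge0.
have /andP[ri0 rie] := re i.
have ri : 0 < r i by exact: le_lt_trans (enorm_ge0 _) yi.
have Dx : enlargement D 1 (x i).
  apply/enlargementP; exists y; first exact: AD.
  by rewrite -enormN opprB (lt_trans yi)// (le_lt_trans rie).
apply: (le_trans (Pc _ _ _ Dx)); first by rewrite ri (le_lt_trans rie ee0).
rewrite -EFinM lee_fin ler_wpM2l ?(ltW c0)// /diam_powR gt_eqF//.
by apply: ge0_ler_powR; rewrite ?nnegrE//; lra.
Unshelve. all: by end_near. Qed.

(** * Processes with moment bounds uniform in the exponent *)

Section uniform_moments.
Context {R : realType} {disp : measure_display} {Omega : measurableType disp}
  {P : probability Omega R} {m d : nat} (v : 'rV[R]_m -> {RV P >-> 'rV[R]_d}).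
Context (v_continuous : forall w, continuous (fun x => v x w : 'rV[R]_d)).
Context (I : set 'rV[R]_m) (D : set 'rV[R]_d) (p : 'rV[R]_m -> 'rV[R]_d -> R)
  (C1 C2 delta : R).
Context (p_density : forall x, has_density (v x) (p x)).
Context (p_bounded : forall x z,
  enlargement I 1 x -> enlargement D 2 z -> p x z <= C1).
Context (delta01 : 0 < delta <= 1).
Context (v_holder : forall q : R, 1 <= q -> forall x y : 'rV[R]_m,
  enlargement I 1 x -> enlargement I 1 y ->
  ('E_P[fun w => (enorm (v x w - v y w : 'rV[R]_d) `^ q)%R]
    <= (C2 * enorm (x - y) `^ (q * delta))%R%:E)%E).

(** Two points of a box are at distance at most [m * eps `^ delta^-1], so the
    Hoelder scale of the increments is at most [m * eps]; taking [(m + 1) * eps]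
    as threshold puts [v x0] in a cube of half-side [K * eps], [K = m + 2]. *)
Lemma hits_grid_box_le : exists c e0 : R, [/\ 0 < c, 0 < e0 <= 1 &
  forall eps z j, 0 < eps < e0 -> enlargement D 1 z ->
    grid_box delta eps j `&` I !=set0 ->
    (P (hits v (grid_box delta eps j) (eball z eps)) <= (c * eps ^+ d)%:E)%E].
Proof.
have /andP[delta0 delta1] := delta01.
pose K : R := m%:R + 2.
have K2 : 2 <= K by rewrite lerDr ler0n.
have dK0 : 0 < K * (d%:R + 1) by rewrite mulr_gt0 ?(lt_le_trans _ K2)// ltr_wpDl.
(* Below this threshold, boxes meeting [I] stay in the 1-enlargement of [I], and
   the cube has Euclidean radius at most [d * K * eps < 1]. *)
exists (`|C1| * (2 * K) ^+ d + 1), (K * (d%:R + 1))^-1; split.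
- by rewrite ltr_wpDl// mulr_ge0// exprn_ge0// mulr_ge0// (le_trans _ K2).
- rewrite invr_gt0 dK0 invf_le1//; have := ler0n R d; nra.
move=> eps z j /andP[eps0 epsK] Dz [x0 [jx0 Ix0]].
have eps_small : eps * (K * (d%:R + 1)) < 1 by rewrite -ltr_pdivlMr// div1r.
have epsK1 : K * eps < 1 by have := ler0n R d; nra.
have eps1 : eps <= 1 by nra.
set s := eps `^ delta^-1.
have s0 : 0 <= s by exact: powR_ge0.
have sdelta : s `^ delta = eps.
  by rewrite -powRrM mulVf ?gt_eqF// powRr1// ltW.
have s_le : s <= eps.
  by apply: ge1r_powR; rewrite ?eps0//= invf_ge1.
have enorm_box x : grid_box delta eps j x -> enorm (x - x0) <= m%:R * s.
  move=> jx; apply: enorm_le => // l.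
  move: (jx l) (jx0 l); rewrite !mxE -/s => /andP[? ?] /andP[? ?].
  by rewrite ler_norml; apply/andP; split; lra.
have ms_lt1 : m%:R * s < 1.
  have : m%:R * s <= m%:R * eps by exact: ler_wpM2l.
  by rewrite /K in epsK1; lra.
have box_near x : grid_box delta eps j x -> enlargement I 1 x.
  by move=> jx; apply/enlargementP; exists x0 => //;
  exact: le_lt_trans (enorm_box _ jx) ms_lt1.
apply: (@le_trans _ _ (C1 * (2 * (eps + (m%:R + 1) * eps)) ^+ d)%:E); last first.
  rewrite lee_fin (_ : 2 * (eps + _) = (2 * K) * eps); last by rewrite /K; ring.
  rewrite exprMn mulrA ler_wpM2r ?exprn_ge0 ?(ltW eps0)//.
  rewrite (@le_trans _ _ (`|C1| * (2 * K) ^+ d))// ?lerDl//.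
  by rewrite ler_wpM2r ?ler_norm// exprn_ge0// mulr_ge0// (le_trans _ K2).
apply: (@hits_ball_le _ _ _ _ _ _ v v_continuous _ x0 (p x0) z eps
  (m%:R * eps) _ C1 `|C2|) => //.
- by rewrite mulr_ge0 ?(ltW eps0)//= ltr_pM2r// ltrDl.
- move=> x jx q q1; apply: (le_trans (v_holder q1 (box_near _ jx) (box_near _ jx0))).
  have q0 : 0 <= q by lra.
  rewrite lee_fin; apply: (@le_trans _ _ (`|C2| * enorm (x - x0) `^ (q * delta))).
    by rewrite ler_wpM2r ?powR_ge0// ler_norm.
  rewrite ler_wpM2l// mulrC powRrM; apply: ge0_ler_powR; rewrite ?nnegrE ?powR_ge0//.
    by rewrite mulr_ge0 ?(ltW eps0).
  apply: (@le_trans _ _ ((m%:R * s) `^ delta)).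
    apply: ge0_ler_powR; rewrite ?nnegrE ?enorm_ge0 ?mulr_ge0//; first exact: ltW.
    exact: enorm_box.
  rewrite powRM// sdelta ler_wpM2r ?(ltW eps0)//.
  case: (m) => [|k]; first by rewrite powR0 // gt_eqF.
  by apply: ler1_powR => //; rewrite ler1n.
- move=> y yz; apply: p_bounded; first exact: box_near.
  have /enlargementP[u Du zu] := Dz; apply/enlargementP; exists u => //.
  have yz1 : enorm (y - z) < 1.
    apply: (@le_lt_trans _ _ (d%:R * (eps + (m%:R + 1) * eps))).
      by apply: enorm_le => //; rewrite addr_ge0 ?mulr_ge0 ?addr_ge0 ?(ltW eps0).
    have : 0 <= m%:R * eps by rewrite mulr_ge0 ?(ltW eps0).
    by rewrite /K in eps_small; lra.
  (* Both terms have norm below 1, so [enorm (y - u) ^+ 2 < 2 * (1 + 1)]. *)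
  have := sqr_enormD (y - z) (z - u); rewrite addrA subrK.
  have := enorm_ge0 (y - z); have := enorm_ge0 (z - u); have := enorm_ge0 (y - u).
  by move: zu yz1; nra.
Qed.

(** Union bound over the boxes of side [s = r `^ delta^-1] that meet [I]: their
    number is of order [s ^- m = r `^ (- (m / delta))], and each has probability
    at most of order [r ^+ d]. *)
Lemma hits_compact_le : compact I -> exists c e0 : R, [/\ 0 < c, 0 < e0 <= 1 &
  forall r z, 0 < r < e0 -> enlargement D 1 z ->
    (P (hits v I (eball z r)) <= (c * r `^ (d%:R - m%:R / delta))%:E)%E].
Proof.
have /andP[delta0 delta1] := delta01.
move=> /compact_bounded/pinfty_ex_gt0[M M0 IM].
have {}IM x : I x -> forall l, `|x ord0 l| <= M.
  move=> /IM xM l; apply: le_trans xM; rewrite -[X in _ <= X]/(mx_norm x) mx_normrE.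
  exact: (le_bigmax _ (fun ij => `|x ij.1 ij.2|) (ord0, l)).
have [c [e0 [c0 /andP[e00 e01] cP]]] := hits_grid_box_le.
have K0 : 0 < (2 * M + 3) ^+ m by rewrite exprn_gt0//; lra.
exists ((2 * M + 3) ^+ m * c), e0; split=> [||r z /andP[r0 re] Dz].
- exact: mulr_gt0.
- by rewrite e00.
set s := r `^ delta^-1.
have s0 : 0 < s by exact: powR_gt0.
have r1 : r <= 1 by exact/ltW/(lt_le_trans re).
have s1 : s <= 1.
  by apply: (le_trans _ r1); apply: ge1r_powR; rewrite ?r0//= invf_ge1.
have s01 : 0 < s <= 1 by rewrite s0.
have [J [sizeJ Jcov]] := grid_cover (ltW M0) IM s01.
have oB := @open_eball _ _ z r.
pose G j := if `[< grid_box delta r j `&` I !=set0 >]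
  then hits v (grid_box delta r j) (eball z r) else set0.
have mG j : measurable (G j).
  by rewrite /G; case: asboolP => // _; exact: measurable_hits.
have PG j : (P (G j) <= (c * r ^+ d)%:E)%E.
  rewrite /G; case: asboolP => [Ij|_]; first by apply: cP => //; rewrite r0.
  by rewrite measure0 lee_fin mulr_ge0 ?exprn_ge0 ?ltW.
have IG : hits v I (eball z r) `<=` \big[setU/set0]_(k < size J) G (nth 0 J k).
  move=> w [y [[x Ix vxy] zy]]; have [j jJ jx] := Jcov _ Ix.
  rewrite -(bigcup_mkord _ (fun k => G (nth 0 J k))).
  exists (index j J); first by rewrite /= index_mem.
  rewrite nth_index// /G asboolT; last by exists x.
  by exists y; split=> //; exists x.
have mI : measurable (hits v I (eball z r)) by exact: measurable_hits.
apply: (le_trans (content_subadditive P (fun k _ => mG (nth 0 J k)) mI IG)).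
apply: (@le_trans _ _ (\sum_(k < size J) (c * r ^+ d)%:E)%E).
  by apply: lee_sum => k _; exact: PG.
rewrite sumEFin sumr_const card_ord lee_fin -[leLHS]mulr_natl.
have -> : r `^ (d%:R - m%:R / delta) = r ^+ d / s ^+ m.
  rewrite powRB; last by rewrite (gt_eqF r0) implybT.
  rewrite powR_mulrn ?(ltW r0)// -[s ^+ m]powR_mulrn ?(ltW s0)// -powRrM.
  by rewrite (mulrC delta^-1).
rewrite [leRHS](_ : _ = (2 * M + 3) ^+ m / s ^+ m * (c * r ^+ d)); last by ring.
by rewrite ler_wpM2r// mulr_ge0 ?exprn_ge0 ?ltW.
Qed.

End uniform_moments.

(** * Hitting probabilities *)

(* The hitting event of a Borel set A need not be measurable (it is so for the
   completion of P); its probability is taken in the sense of the outer measure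
   mu_ext P, which extends P, and also its completion. *)
Theorem theorem2p4 (R : realType) (disp : measure_display)
    (Omega : measurableType disp) (P : probability Omega R)
    (m d : nat) (m_ge1 : (1 <= m)%N) (d_ge1 : (1 <= d)%N)
    (v : 'rV[R]_m -> {RV P >-> 'rV[R]_d})
    (v_continuous : forall w, continuous (fun x => v x w : 'rV[R]_d))
    (I : set 'rV[R]_m) (I_compact : compact I)
    (I_pos : (0 < lebesgue_rV I)%E)
    (D : set 'rV[R]_d)
    (p : 'rV[R]_m -> 'rV[R]_d -> R)
    (p_density : forall x, has_density (v x) (p x))
    (C1 : R)
    (p_bounded :
      (ereal_sup [set ereal_sup [set (p x z)%:E | x in enlargement I 1%R]
                 | z in enlargement D 2%R] <= C1%:E)%E)
    (delta : R) (delta_gt0 : 0 < delta) (delta_le1 : delta <= 1)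
    (C2 : R)
    (v_holder : forall q : R, 1 <= q -> forall x y : 'rV[R]_m,
      enlargement I 1 x -> enlargement I 1 y ->
      ('E_P[fun w => (enorm (v x w - v y w : 'rV[R]_d) `^ q)%R]
        <= (C2 * enorm (x - y) `^ (q * delta))%R%:E)%E) :
  (forall gamma : R, 0 < gamma < d%:R ->
    exists2 c : R, 0 < c &
      \forall eps \near 0^'+, 0 < eps < 1 ->
        forall z : 'rV[R]_d, enlargement D 1 z ->
        forall j : 'rV[int]_m, grid_box delta eps j `&` I !=set0 ->
          (P (hits v (grid_box delta eps j) (eball z eps))
             <= (c * eps `^ gamma)%R%:E)%E) /\
  (forall gamma : R, 0 < gamma < d%:R ->
    exists2 C : R, 0 < C &
      forall A : set 'rV[R]_d, measurable A -> A `<=` D ->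
        (mu_ext P (hits v I A)
           <= C%:E * hausdorff_measure (gamma - m%:R / delta)%R A)%E).
Proof.
have delta01 : 0 < delta <= 1 by rewrite delta_gt0.
have p_le x z : enlargement I 1 x -> enlargement D 2 z -> p x z <= C1.
  move=> Ix Dz; rewrite -lee_fin; apply: le_trans p_bounded.
  apply: (@le_trans _ _ (ereal_sup [set (p x z)%:E | x in enlargement I 1])).
    by apply: ereal_sup_ubound; exists x.
  by apply: ereal_sup_ubound; exists z.
split=> gamma /andP[gamma0 gammad].
  have [c [e0 [c0 /andP[e00 _] cP]]] :=
    hits_grid_box_le v_continuous p_density p_le delta01 v_holder.
  exists c => //; near=> eps => /andP[eps0 eps1] z Dz j jI.
  apply: (le_trans (cP eps z j _ Dz jI)).
    by rewrite eps0 /=; near: eps; exact: nbhs_right_lt.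
  rewrite lee_fin ler_wpM2l ?(ltW c0)// -powR_mulrn ?(ltW eps0)//.
  by apply: ger_powR; rewrite ?eps0 ltW.
have [c [e0 [c0 /andP[e00 e01] cP]]] :=
  hits_compact_le v_continuous p_density p_le delta01 v_holder I_compact.
exists c => // A _ AD.
(* For a negative index the Hausdorff measure is infinite by convention. *)
have [neg|pos] := ltP (gamma - m%:R / delta) 0.
  by rewrite /hausdorff_measure neg gt0_muley ?lee_fin ?leey// lte_fin.
apply: (mu_ext_hits_le v_continuous pos c0 e00 AD) => r z r_e0 Dz.
apply: (le_trans (cP r z r_e0 Dz)); rewrite lee_fin ler_wpM2l ?(ltW c0)//.
have /andP[r0 re] := r_e0; apply: ger_powR.
  by rewrite r0 ltW// (lt_le_trans re).
by rewrite lerD2r ltW.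
Unshelve. all: by end_near. Qed.
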